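(* Let $(G,c,o)$ be a recurrent rooted network with vertex set $V$. Then $(G,c,o)$ has a unique potential if and only if every finite nonempty set $A\subset V$ admits harmonic measure from infinity. In this case, the unique potential $h$ and the collection of harmonic measures from infinity on finite sets can be computed from each other as follows. (a) For all $z\in V\setminus\{o\}$, $h(z)=\omega_\infty^{\{o,z\}}(z)\,\mathsf{g}_o(z,z)$. (b) If $A\subset V$ is finite, $o\in A$ and $z\in A\setminus\{o\}$, then $$\omega_\infty^A(z)=\frac{\det(M^{h,z})}{\det(M)},$$ where $M$ is the invertible matrix $M=\big(\mathsf{g}_o(x,y)\big)_{x,y\in A\setminus\{o\}}$, and $M^{h,z}$ is obtained from $M$ by replacing the $z$-column with the vector $(h(x))_{x\in A\setminus\{o\}}$. (c) If $A\subset V$ is finite and nonempty and $o\notin A$, choose $\tilde o\in A$. Then the function $\tilde h(\cdot)=h(\cdot)+\mathsf{g}_{\tilde o}(\cdot,o)-h(\tilde o)$ is the unique potential for the rooted network $(G,c,\tilde o)$, and $\omega_\infty^A$ is given by the formula in (b) with $\tilde h$ in place of $h$ and $\tilde o$ in place of $o$; i.e. for $z\in A\setminus\{\tilde o\}$, $\omega_\infty^A(z)=\det(\tilde M^{\tilde h,z})/\det(\tilde M)$ where $\tilde M=\big(\mathsf{g}_{\tilde o}(x,y)\big)_{x,y\in A\setminus\{\tilde o\}}$ is invertible and $\tilde M^{\tilde h,z}$ is obtained from $\tilde M$ by replacing the $z$-column with $(\tilde h(x))_{x\in A\setminus\{\tilde o\}}$.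
   Context: A network $(G,c)$ is an infinite, connected, locally finite graph $G=(V,E)$ with positive edge weights (conductances) $c_{xy}=c_{yx}$, $xy\in E$; put $c_x=\sum_{z\sim x}c_{xz}$. The network random walk $\{X_n\}$ is the Markov chain on $V$ with transition probabilities $p(x,y)=c_{xy}/c_x$ for $x\sim y$; $\mathbb{P}_x$ is its law started at $x$. The network is recurrent if this walk is recurrent. A rooted network $(G,c,o)$ is a network with a distinguished vertex $o\in V$. The Laplacian of $f:V\to\mathbb{R}$ is $\Delta f(v)=\sum_{x\sim v}c_{vx}(f(x)-f(v))$. A potential on $(G,c,o)$ is a function $h:V\to[0,\infty)$ with $h(o)=0$, $\Delta h(o)=1$ and $\Delta h(v)=0$ for every $v\ne o$. The Green density of the walk killed at a vertex $o$ is $\mathsf{g}_o(x,y)=\frac1{c_y}\sum_{n\ge0}\mathbb{P}_x(X_n=y,\ \tau_o>n)$, where $\tau_o=\min\{n\ge0:X_n=o\}$; it is symmetric in $x,y$. For a finite nonempty $A\subset V$, let $\tau_A=\min\{n\ge 0:X_n\in A\}$. The harmonic measure from $v$ on $A$ is $\omega_v^A(z)=\mathbb{P}_v(X_{\tau_A}=z)$, $z\in A$. The set $A$ admits harmonic measure from infinity if the limit $\omega_\infty^A(z)=\lim_{v\to\infty}\omega_v^A(z)$ exists for all $z\in A$, where $v\to\infty$ means that $v$ eventually leaves every finite subset of $V$. *)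

(* Defs.v *)
From mathcomp Require Import all_boot all_order all_algebra finmap.
From mathcomp Require Import all_classical all_reals all_analysis.

Set Implicit Arguments.
Unset Strict Implicit.
Unset Printing Implicit Defensive.

Import Order.TTheory GRing.Theory Num.Theory.
Import numFieldNormedType.Exports.

Local Open Scope classical_set_scope.
Local Open Scope ring_scope.

(* Only the values of [cond] on edges are meaningful.  [adj] is not required
   to be irreflexive, so loops are allowed. *)
Record network (R : realType) (V : choiceType) := Network {
  adj : rel V ;
  cond : V -> V -> R ;
  adj_sym : symmetric adj ;
  cond_sym : forall x y, adj x y -> cond x y = cond y x ;
  cond_gt0 : forall x y, adj x y -> 0 < cond x y ;
  vertices_infinite : infinite_set [set: V] ;
  locally_finite : forall x, finite_set [set y | adj x y] ;
  network_connected : forall x y, exists2 p, path adj x p & last x p = y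
}.

Definition vertex_infty {V : choiceType} : set_system V := @frechet_filter V.

Section Network.
Context {R : realType} {V : choiceType} (N : network R V).

Definition total_cond (x : V) : R :=
  \sum_(z \in [set z | adj N x z]) cond N x z.

Definition transition (x y : V) : R :=
  if adj N x y then cond N x y / total_cond x else 0.

Definition laplacian (f : V -> R) (v : V) : R :=
  \sum_(x \in [set x | adj N v x]) cond N v x * (f x - f v).

Definition potential (o : V) (h : V -> R) : Prop :=
  [/\ forall v, 0 <= h v,
      h o = 0,
      laplacian h o = 1
    & forall v, v != o -> laplacian h v = 0].

(* A realization of the Markov chain with kernel [transition]: under
   [walk_law x] it starts at [x], and [walk_step] is the Markov property
   P(X_0 = s_0, ..., X_(n+1) = s_(n+1))
     = P(X_0 = s_0, ..., X_n = s_n) p(s_n, s_(n+1)).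
   These clauses determine the law of (X_n) under each [walk_law x]. *)
Record network_walk d (Omega : measurableType d) := NetworkWalk {
  walk_law : V -> probability Omega R ;
  walk : nat -> Omega -> V ;
  walk_measurable : forall n (B : set V), measurable (walk n @^-1` B) ;
  walk_start : forall x, walk_law x [set w | walk 0%N w = x] = 1%E ;
  walk_step : forall x (s : nat -> V) n,
    walk_law x [set w | forall k, (k <= n.+1)%N -> walk k w = s k] =
    (walk_law x [set w | forall k, (k <= n)%N -> walk k w = s k]
      * (transition (s n) (s n.+1))%:E)%E
}.

Section Walk.
Context {d} {Omega : measurableType d} (W : network_walk Omega).

Definition recurrent : Prop :=
  forall x, walk_law W x [set w | exists2 n, (0 < n)%N & walk W n w = x] = 1%E.

(* [None] stands for an infinite hitting time. *)
Definition hitting_time (A : {fset V}) (w : Omega) : option nat :=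
  if pselect (exists n, walk W n w \in A) is left hitA
  then Some (ex_minn hitA) else None.

Definition hits_after (A : {fset V}) (n : nat) (w : Omega) : bool :=
  if hitting_time A w is Some k then (n < k)%N else true.

(* [fine] sends an infinite value to 0; for a recurrent walk the series
   converges. *)
Definition green (o x y : V) : R :=
  fine (((total_cond y)^-1)%:E *
    \sum_(0 <= n <oo)
      walk_law W x [set w | walk W n w = y /\ hits_after [fset o]%fset n w])%E.

Definition harmonic_measure (A : {fset V}) (v z : V) : R :=
  fine (walk_law W v
    [set w | exists2 n, hitting_time A w = Some n & walk W n w = z]).

Definition admits_harmonic_measure (A : {fset V}) : Prop :=
  forall z, z \in A ->
    cvg (harmonic_measure A v z @[v --> vertex_infty]).

Definition harmonic_measure_infty (A : {fset V}) (z : V) : R :=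
  lim (harmonic_measure A v z @[v --> vertex_infty]).

(* Matrices indexed by a finite set are written along its enumeration; the
   ratios of determinants considered do not depend on that ordering. *)
Definition fset_elt (B : {fset V}) (i : 'I_#|`B|) : V :=
  tnth (in_tuple (enum_fset B)) i.

Definition green_mx (o : V) (B : {fset V}) : 'M[R]_#|`B| :=
  \matrix_(i, j) green o (fset_elt i) (fset_elt j).

Definition green_mx_col (o : V) (B : {fset V}) (h : V -> R) (z : V) :
    'M[R]_#|`B| :=
  \matrix_(i, j) if fset_elt j == z then h (fset_elt i)
                 else green o (fset_elt i) (fset_elt j).

End Walk.
End Network.

(* Main.v *)
Require Import Defs.
From mathcomp Require Import all_boot all_order all_algebra finmap.
From mathcomp Require Import all_classical all_reals all_analysis.
From mathcomp Require Import ring lra.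

(* Every function bounded below, superharmonic off a finite nonempty set and
   nonnegative on it is nonnegative, by recurrence.  Hence a bounded function
   f that vanishes at o and is harmonic off a finite set A is determined by its
   Laplacian: f = sum over y in A minus o of -(Laplacian f)(y) g_o(., y).

   For finite K containing o, apply this to the bounded harmonic extension f of
   the restriction to K of a potential h.  Since f <= h with equality on K,
   the weights -(Laplacian f)(y) are nonnegative; they are carried by the inner
   boundary of K and sum to 1 because g_o(., y) has Laplacian 1 at o.  So h(x)
   is a convex combination of the values g_o(x, y) with y far away: if
   g_o(x, .) converges at infinity for all x, the limit is the only possible
   potential, and it is one.  Conversely, any limit of g_o(x, .) along an
   ultrafilter finer than v -> oo is a potential, so uniqueness forces
   g_o(x, v) -> h(x).  As g_o(v, z) is the harmonic measure of z from v on
   {o, z} times g_o(z, z), and the harmonic measure on a set A containing o is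
   a fixed linear combination of the g_o(., y), y in A, whose coefficients form
   the inverse of M, limits of Green densities and harmonic measures from
   infinity are equivalent data, related by Cramer's rule. *)

Set Implicit Arguments.
Unset Strict Implicit.
Unset Printing Implicit Defensive.

Import Order.TTheory GRing.Theory Num.Theory.
Import numFieldNormedType.Exports.

Local Open Scope classical_set_scope.
Local Open Scope ring_scope.

(** * Averaging over neighbours *)

Lemma real_cvg_unique (R : realType) (I : Type) (F : set_system I)
    {FF : ProperFilter F} (f : I -> R) (a b : R) :
  f i @[i --> F] --> a -> f i @[i --> F] --> b -> a = b.
Proof. exact: (@norm_cvg_unique _ R (f @ F)). Qed.

Arguments real_cvg_unique {R I F FF} f {a b} _ _.

Section Averaging.
Context {R : realType} {V : choiceType} (N : network R V).

Definition nbrs (x : V) : seq V := enum_fset (fset_set [set y | adj N x y]).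

Lemma mem_nbrs x y : (y \in nbrs x) = adj N x y.
Proof.
rewrite /nbrs in_fset_set; last exact: locally_finite.
by apply/idP/idP => [|h]; rewrite inE.
Qed.

Lemma nbrs_uniq x : uniq (nbrs x).
Proof. exact: fset_uniq. Qed.

Lemma nbrs_sumE x (F : V -> R) :
  \sum_(y \in [set y | adj N x y]) F y = \sum_(y <- nbrs x) F y.
Proof. by rewrite fsbig_finite//; exact: locally_finite. Qed.

Lemma total_condE x : total_cond N x = \sum_(y <- nbrs x) cond N x y.
Proof. exact: nbrs_sumE. Qed.

Lemma exists_nbr x : exists y, adj N x y.
Proof.
have [z zx] : exists z, z != x.
  apply: contrapT => nz; apply: (vertices_infinite N).
  apply: (@sub_finite_set _ _ [set x]) => // z _ /=.
  by apply/eqP; apply: contra_notT nz => ?; exists z.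
have [[|y p] /= + lp] := network_connected N x z.
  by move: zx; rewrite -lp eqxx.
by case/andP => xy _; exists y.
Qed.

Lemma total_cond_gt0 x : 0 < total_cond N x.
Proof.
have [y xy] := exists_nbr x.
rewrite total_condE (big_rem y) ?mem_nbrs//=.
apply: ltr_pwDl; first exact: cond_gt0.
rewrite big_seq; apply: sumr_ge0 => z /mem_rem; rewrite mem_nbrs => /cond_gt0.
exact: ltW.
Qed.

Lemma transition_ge0 x y : 0 <= transition N x y.
Proof.
rewrite /transition; case: ifPn => // xy.
by rewrite ltW// divr_gt0 ?cond_gt0 ?total_cond_gt0.
Qed.

Lemma transition_gt0 x y : adj N x y -> 0 < transition N x y.
Proof.
by move=> xy; rewrite /transition xy divr_gt0 ?cond_gt0 ?total_cond_gt0.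
Qed.

(** Detailed balance: on an edge both sides are its conductance, off the edges both vanish. *)
Lemma transition_reversible x y :
  total_cond N x * transition N x y = total_cond N y * transition N y x.
Proof.
rewrite /transition adj_sym; case: ifPn => xy; last by rewrite !mulr0.
by rewrite !mulrA !(mulrAC _ (cond _ _ _)) !divff ?gt_eqF ?total_cond_gt0//
  !mul1r cond_sym// adj_sym.
Qed.

Lemma transition_sum x : \sum_(y <- nbrs x) transition N x y = 1.
Proof.
rewrite (eq_big_seq (fun y => cond N x y / total_cond N x)) => [|y]; last first.
  by rewrite mem_nbrs /transition => ->.
by rewrite -mulr_suml -total_condE divff ?gt_eqF ?total_cond_gt0.
Qed.

(** The Markov operator of the walk. Unlike the Laplacian it is monotone, which the comparison
    arguments exploit. *)
Definition avg (f : V -> R) (x : V) : R :=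
  \sum_(y <- nbrs x) transition N x y * f y.

Lemma laplacianE f x : laplacian N f x = total_cond N x * (avg f x - f x).
Proof.
rewrite /laplacian nbrs_sumE mulrBr /avg mulr_sumr.
rewrite [X in _ - X * _]total_condE mulr_suml -sumrB.
apply: eq_big_seq => y; rewrite mem_nbrs => xy.
rewrite mulrBr mulrA; congr (_ * _ - _).
by rewrite /transition xy mulrCA divff ?mulr1// gt_eqF// total_cond_gt0.
Qed.

Lemma eq_avg f g x : (forall y, adj N x y -> f y = g y) -> avg f x = avg g x.
Proof.
by move=> fg; apply: eq_big_seq => y; rewrite mem_nbrs => /fg ->.
Qed.

Lemma avg_cst (a : R) x : avg (fun=> a) x = a.
Proof. by rewrite /avg -mulr_suml transition_sum mul1r. Qed.

Lemma avgD f g x : avg (fun y => f y + g y) x = avg f x + avg g x.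
Proof. by rewrite /avg -big_split/=; apply: eq_bigr => y _; rewrite mulrDr. Qed.

Lemma avgZ a f x : avg (fun y => a * f y) x = a * avg f x.
Proof. by rewrite /avg mulr_sumr; apply: eq_bigr => y _; rewrite mulrCA. Qed.

Lemma avgN f x : avg (fun y => - f y) x = - avg f x.
Proof. by rewrite /avg -sumrN; apply: eq_bigr => y _; rewrite mulrN. Qed.

Lemma avgB f g x : avg (fun y => f y - g y) x = avg f x - avg g x.
Proof. by rewrite avgD avgN. Qed.

Lemma avg_sum (I : Type) (r : seq I) (F : I -> V -> R) x :
  avg (fun y => \sum_(i <- r) F i y) x = \sum_(i <- r) avg (F i) x.
Proof.
by rewrite /avg exchange_big/=; apply: eq_bigr => y _; rewrite mulr_sumr.
Qed.

Lemma le_avg f g x : (forall y, adj N x y -> f y <= g y) -> avg f x <= avg g x.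
Proof.
move=> fg; rewrite /avg big_seq [leRHS]big_seq.
apply: ler_sum => y; rewrite mem_nbrs => /fg.
exact/ler_wpM2l/transition_ge0.
Qed.

Lemma avg_ge0 f x : (forall y, 0 <= f y) -> 0 <= avg f x.
Proof. by move=> f0; rewrite -(avg_cst 0 x); apply: le_avg. Qed.

Lemma avg_eq x y : avg (fun z => (z == y)%:R) x = transition N x y.
Proof.
rewrite /avg; have [xy|nxy] := boolP (adj N x y).
  rewrite (bigD1_seq y) ?mem_nbrs ?nbrs_uniq//= eqxx mulr1 big1 ?addr0// => z.
  by move=> /negPf->; rewrite mulr0.
rewrite big_seq big1 => [|z]; first by rewrite /transition (negPf nxy).
rewrite mem_nbrs => xz; case: eqP => [zy|]; last by rewrite mulr0.
by rewrite -zy xz in nxy.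
Qed.

Lemma cvg_avg (I : Type) (F : set_system I) (FF : Filter F)
    (f : I -> V -> R) (g : V -> R) x :
  (forall y, f i y @[i --> F] --> g y) -> avg (f i) x @[i --> F] --> avg g x.
Proof.
move=> fg; apply: cvg_big; first exact: add_continuous.
by move=> y _; apply: cvgM; [exact: cvg_cst|exact: fg].
Qed.

Lemma avg_max_nbr f m x : (forall y, f y <= m) -> avg f x = m ->
  forall y, adj N x y -> f y = m.
Proof.
move=> fm fx y xy; apply/eqP; rewrite eq_le fm/= leNgt; apply/negP => ltm.
suff : avg f x < m by rewrite fx ltxx.
rewrite -[ltRHS](avg_cst m x) /avg.
rewrite (bigD1_seq y) ?mem_nbrs ?nbrs_uniq//=.
rewrite [ltRHS](bigD1_seq y) ?mem_nbrs ?nbrs_uniq//=.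
apply: ltr_leD; first by rewrite ltr_pM2l// transition_gt0.
by apply: ler_sum => z _; apply: ler_wpM2l; rewrite ?transition_ge0.
Qed.

(** The maximum spreads from a vertex to its neighbours, hence along paths to the whole connected
    graph. *)
Lemma harmonic_attains_max f m a : (forall y, f y <= m) ->
  (forall x, avg f x = f x) -> f a = m -> forall x, f x = m.
Proof.
move=> fm fh fa x; have [p + <-] := network_connected N a x.
elim: p a fa => //= y p ih a fa /andP[ay]; apply: ih.
by apply: (avg_max_nbr fm _ ay); rewrite fh.
Qed.

End Averaging.

Arguments cvg_avg {R V} N {I F FF f g} x _.

(** * The law of finite pieces of the walk *)

Section PathExpectation.
Context {R : realType} {V : choiceType} (N : network R V).
Local Notation avg := (avg N).

Fixpoint walks (n : nat) (x : V) : seq (seq V) :=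
  if n is m.+1 then [seq x :: s | y <- nbrs N x, s <- walks m y]
  else [:: [:: x]].

(* The expectation of [phi (X_0, ..., X_n)] for the walk started at [x]. *)
Fixpoint expect (n : nat) (phi : seq V -> R) (x : V) : R :=
  if n is m.+1 then avg (fun y => expect m (fun s => phi (x :: s)) y) x
  else phi [:: x].

Lemma size_walks n x s : s \in walks n x -> size s = n.+1.
Proof.
elim: n x s => [|n ih] x s /=; first by rewrite inE => /eqP->.
by move=> /allpairsPdep[y [t [_ /ih <- ->]]].
Qed.

Lemma mem_walks x p : path (adj N) x p -> x :: p \in walks (size p) x.
Proof.
elim: p x => [|y p ih] x /=; first by rewrite inE.
move=> /andP[xy /ih yp]; apply/allpairsPdep.
by exists y, (y :: p); rewrite mem_nbrs.
Qed.

(** Every vertex ends a finite walk from a fixed vertex, and each length allows finitely many walks.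
    Countability is what makes events about the trace measurable. *)
Lemma countable_vertices : countable [set: V].
Proof.
have [x _] : [set: V] !=set0.
  apply/set0P/eqP => V0; apply: (vertices_infinite N); rewrite V0.
  exact: finite_set0.
rewrite (_ : [set: V] =
  \bigcup_(n in setT) [set` [seq last x s | s <- walks n x]]).
  by apply: bigcup_countable => // n _; exact: finite_set_countable.
apply/esym/seteqP; split=> // y _.
have [p /mem_walks xp lp] := network_connected N x y.
by exists (size p) => //=; apply/mapP; exists (x :: p).
Qed.

Lemma eq_expect_walks n phi psi x :
  {in walks n x, phi =1 psi} -> expect n phi x = expect n psi x.
Proof.
elim: n phi psi x => [|n ih] phi psi x /= h; first by apply: h; rewrite inE.
apply: eq_avg => y xy; apply: ih => s sy; apply: h.
by apply/allpairsPdep; exists y, s; rewrite mem_nbrs.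
Qed.

Lemma eq_expect n phi psi x : phi =1 psi -> expect n phi x = expect n psi x.
Proof. by move=> h; apply: eq_expect_walks => s _. Qed.

Lemma expect_cst n (a : R) x : expect n (fun=> a) x = a.
Proof.
elim: n x => //= n ih x; rewrite -[RHS](avg_cst N a x).
by apply: eq_avg => y _.
Qed.

Lemma expectZ n a phi x :
  expect n (fun s => a * phi s) x = a * expect n phi x.
Proof.
elim: n phi x => //= n ih phi x; rewrite -avgZ.
by apply: eq_avg => y _; rewrite ih.
Qed.

Lemma expectB n phi psi x :
  expect n (fun s => phi s - psi s) x = expect n phi x - expect n psi x.
Proof.
elim: n phi psi x => //= n ih phi psi x; rewrite -avgB.
by apply: eq_avg => y _; rewrite ih.
Qed.

Lemma expect_sum (I : Type) (r : seq I) n (phi : I -> seq V -> R) x :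
  expect n (fun s => \sum_(i <- r) phi i s) x =
  \sum_(i <- r) expect n (phi i) x.
Proof.
elim: n phi x => //= n ih phi x; rewrite -avg_sum.
by apply: eq_avg => y _; rewrite ih.
Qed.

Lemma expect_walks n phi x : expect n phi x =
  \sum_(s <- undup (walks n x)) phi s * expect n (fun t => (t == s)%:R) x.
Proof.
under eq_bigr do rewrite -expectZ.
rewrite -expect_sum; apply: eq_expect_walks => s sx.
rewrite (bigD1_seq s) ?mem_undup ?undup_uniq//= eqxx mulr1 big1 ?addr0// => t.
by rewrite eq_sym => /negPf->; rewrite mulr0.
Qed.

Lemma expect_path n (s : nat -> V) x :
  expect n (fun t => (t == mkseq s n.+1)%:R) x =
  (x == s 0%N)%:R * \prod_(i < n) transition N (s i) (s i.+1).
Proof.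
elim: n s x => [|n ih] s x.
  by rewrite /= big_ord0 mulr1 eqseq_cons eqxx andbT.
have -> : mkseq s n.+2 = s 0%N :: mkseq (s \o S) n.+1.
  by rewrite /mkseq map_comp -(iotaDl 1 0).
rewrite /=.
have [->|xs0] := eqVneq x (s 0%N); last first.
  rewrite mul0r -[RHS](avg_cst N 0 x); apply: eq_avg => y _.
  rewrite -[RHS](expect_cst n 0 y); apply: eq_expect => t.
  by rewrite eqseq_cons (negPf xs0).
under [LHS]eq_avg => y _.
  under eq_expect => t do rewrite eqseq_cons eqxx /=.
  rewrite (ih (s \o S)) mulrC; over.
by rewrite avgZ avg_eq mul1r big_ord_recl mulrC.
Qed.

End PathExpectation.

(** * Agreement of the law of the walk with finite expectations *)

Section Law.
Context {R : realType} {V : choiceType} (N : network R V).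
Context {d} {Omega : measurableType d} (W : network_walk N Omega).

Definition trace (n : nat) (w : Omega) : seq V :=
  mkseq (fun k => walk W k w) n.+1.

Lemma measurable_trace n (P : pred (seq V)) :
  measurable [set w | P (trace n w)].
Proof.
rewrite /trace; elim: n.+1 P => {n} [|n ih] P.
  rewrite /mkseq/=; case: (P [::]).
    by rewrite [X in measurable X](_ : _ = setT)//; apply/seteqP; split.
  by rewrite [X in measurable X](_ : _ = set0)//; apply/seteqP; split.
rewrite [X in measurable X](_ : _ = \bigcup_v ((walk W n @^-1` [set v]) `&`
    [set w | P (rcons (mkseq (fun k => walk W k w) n) v)])).
  apply: countable_bigcupT_measurable; first exact: (countable_vertices N).
  move=> v; apply: measurableI; first exact: walk_measurable.
  exact: (ih (fun s => P (rcons s v))).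
apply/seteqP; split => w /=; rewrite mkseqS.
  by move=> Pw; exists (walk W n w).
by move=> [v _ [<-]].
Qed.

Lemma walk_law_start x y :
  walk_law W x [set w | walk W 0%N w = y] = (x == y)%:R%:E.
Proof.
have [->|xy] := eqVneq x y; first exact: walk_start.
have m z : measurable [set w | walk W 0%N w = z].
  exact: (walk_measurable W 0 [set z]).
apply/eqP; rewrite eq_le measure_ge0 andbT.
have <- : walk_law W x (~` [set w | walk W 0%N w = x]) = 0%:E.
  by rewrite probability_setC// walk_start subee.
apply: le_measure; rewrite ?inE//; first exact: measurableC.
by move=> w /= -> /esym/eqP; rewrite (negPf xy).
Qed.

Lemma walk_law_path n (s : nat -> V) x :
  walk_law W x [set w | forall k, (k <= n)%N -> walk W k w = s k] =
  ((x == s 0%N)%:R * \prod_(i < n) transition N (s i) (s i.+1))%:E.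
Proof.
elim: n => [|n ih]; last by rewrite walk_step ih big_ord_recr/= mulrA -EFinM.
rewrite big_ord0 mulr1 -walk_law_start; congr (walk_law W x _).
apply/seteqP; split => w /=; first exact.
by move=> ws k; rewrite leqn0 => /eqP->.
Qed.

Lemma trace_eqE n s : size s = n.+1 -> forall x0,
  [set w | trace n w == s] =
  [set w | forall k, (k <= n)%N -> walk W k w = nth x0 s k].
Proof.
move=> ss x0; apply/seteqP; split => w /=.
  by move=> /eqP <- k kn; rewrite nth_mkseq.
move=> h; apply/eqP/(@eq_from_nth _ x0); first by rewrite size_mkseq.
by rewrite size_mkseq => k kn; rewrite nth_mkseq// h.
Qed.

Lemma walk_law_trace_eq n s x : size s = n.+1 ->
  walk_law W x [set w | trace n w == s] =
  (expect N n (fun t => (t == s)%:R) x)%:E.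
Proof.
move=> ss; rewrite (trace_eqE ss x) walk_law_path -expect_path.
congr (_%:E); apply: eq_expect => t; congr ((_ == _)%:R).
by rewrite -ss mkseq_nth.
Qed.

(* The paths from [x] of length [n] that satisfy [P], and those that do not,
   give lower bounds that add up to 1. *)
Lemma walk_law_trace n (P : pred (seq V)) x :
  walk_law W x [set w | P (trace n w)] =
  (expect N n (fun s => (P s)%:R) x)%:E.
Proof.
have lower (Q : pred (seq V)) : ((expect N n (fun s => (Q s)%:R) x)%:E <=
    walk_law W x [set w | Q (trace n w)])%E.
  set S := [seq s <- undup (walks N n x) | Q s].
  have SE s : s \in S -> Q s /\ size s = n.+1.
    by rewrite mem_filter mem_undup => /andP[Qs /size_walks].
  have -> : (expect N n (fun s => (Q s)%:R) x)%:E =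
    walk_law W x (\bigcup_(s in [set` S]) [set w | trace n w == s]).
    rewrite measure_fin_bigcup; last 3 first.
    - exact: finite_seq.
    - by move=> s t _ _ [w [/= /eqP<- /eqP<-]].
    - by move=> s _; exact: (measurable_trace n (pred1 s)).
    rewrite expect_walks -fsbig_seq; last by rewrite filter_uniq ?undup_uniq.
    rewrite big_filter [RHS]big_mkcond/= -sumEFin; apply: eq_big_seq => s.
    rewrite mem_undup => /size_walks ss; rewrite walk_law_trace_eq//.
    by case: (Q s); rewrite ?mul1r ?mul0r.
  apply: le_measure; rewrite ?inE.
  - apply: fin_bigcup_measurable => // s _.
    exact: (measurable_trace n (pred1 s)).
  - exact: measurable_trace.
  - by move=> w [s /= /SE[Qs _] /eqP->].
apply/eqP; rewrite eq_le lower andbT.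
have := lower (predC P).
rewrite (_ : [set w | predC P (trace n w)] = ~` [set w | P (trace n w)]); last first.
  by apply/seteqP; split => w /= /negP.
rewrite probability_setC; last exact: measurable_trace.
rewrite (@eq_expect _ _ N _ _ (fun s => 1 - (P s)%:R)); last first.
  by move=> s /=; case: (P s); rewrite ?subrr ?subr0.
rewrite expectB expect_cst.
have := fin_num_measure (walk_law W x) _ (measurable_trace n P).
move=> /fineK <-; rewrite -EFinB !lee_fin; lra.
Qed.

(** Continuity from below along increasing events; hitting and return probabilities are reached in
    this way. *)
Lemma walk_law_trace_cvg (P : pred (seq V)) (x : V) :
  (forall s v, P s -> P (rcons s v)) ->
  (expect N n (fun s => (P s)%:R) x)%:E @[n --> \oo] -->
  walk_law W x [set w | exists n, P (trace n w)].
Proof.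
move=> Pmono; under eq_cvg => n do rewrite -walk_law_trace.
rewrite (_ : [set w | _] = \bigcup_n [set w | P (trace n w)]); last first.
  by apply/seteqP; split => w /= [n]; exists n.
apply: nondecreasing_cvg_mu.
- by move=> n; exact: measurable_trace.
- by apply: bigcupT_measurable => n; exact: measurable_trace.
- apply/nondecreasing_seqP => n; apply/subsetPset => w /= Pw.
  by rewrite /trace mkseqS; apply: Pmono.
Qed.

End Law.

Arguments walk_law_trace_cvg {R V N d Omega} W {P} x _.

(** * Hitting probabilities and the minimum principle *)

Section HarmonicMeasure.
Context {R : realType} {V : choiceType} (N : network R V).
Context {d} {Omega : measurableType d} (W : network_walk N Omega).
Implicit Types (A : {fset V}).
Local Notation avg := (avg N).
Local Notation hm := (harmonic_measure W).

Lemma hitting_timeP A w k : hitting_time W A w = Some k <->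
  walk W k w \in A /\ forall j, (j < k)%N -> walk W j w \notin A.
Proof.
rewrite /hitting_time; case: pselect => [hitA|nhit]; split => //.
- move=> [<-]; case: ex_minnP => m mA mmin; split=> // j.
  by rewrite ltnNge; apply: contra => /mmin.
- move=> [kA kmin]; congr Some; case: ex_minnP => m mA mmin.
  by apply/eqP; rewrite eqn_leq mmin//= leqNgt; apply: contraL mA => /kmin.
- by move=> [kA _]; case: nhit; exists k.
Qed.

Lemma hitting_time_None A w :
  hitting_time W A w = None -> forall n, walk W n w \notin A.
Proof.
rewrite /hitting_time; case: pselect => // nhit _ n.
by apply: contra_notN nhit => nA; exists n.
Qed.

(** Phrased through the first entry of [s] in [A], so that it persists when [s] is extended, as
    [walk_law_trace_cvg] requires. *)
Definition first_hit A z (s : seq V) : bool :=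
  ohead [seq y <- s | y \in A] == Some z.

Lemma first_hit_rcons A z s v : first_hit A z s -> first_hit A z (rcons s v).
Proof.
rewrite /first_hit filter_rcons.
by case: (seq.filter _ s) => [|x t] /=; case: ifP.
Qed.

Lemma first_hit_mkseq A z n w : first_hit A z (mkseq (fun k => walk W k w) n) <->
  exists k, [/\ (k < n)%N, hitting_time W A w = Some k & walk W k w = z].
Proof.
elim: n => [|n ih]; first by split => // -[? []].
rewrite mkseqS; split=> [|[k []]].
  have [/ih[k [kn hk kz]] _|nhit] := boolP
      (first_hit A z (mkseq (fun k => walk W k w) n)).
    by exists k; split=> //; exact: ltnW.
  rewrite /first_hit filter_rcons.
  case E : [seq _ <- _ | _] => [|y s].
    case: ifPn => // nA /= /eqP[nz]; exists n; split=> //; apply/hitting_timeP.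
    split=> // j jn; apply/negP => jA.
    have : walk W j w \in [seq y <- mkseq (fun k => walk W k w) n | y \in A].
      by rewrite mem_filter jA; apply/mapP; exists j; rewrite ?mem_iota.
    by rewrite E.
  move: nhit; rewrite /first_hit E /=.
  by case: ifP => _ /= /negP.
rewrite ltnS leq_eqVlt => /orP[/eqP->|kn hk kz]; last first.
  by apply: first_hit_rcons; apply/ih; exists k.
move=> /hitting_timeP[nA nmin] nz; rewrite /first_hit filter_rcons nA.
rewrite (_ : [seq _ <- _ | _] = [::]) /= ?nz//.
apply/eqP; rewrite -[_ == _]negbK -has_filter; apply/hasPn => y /mapP[j].
by rewrite mem_iota => /andP[_ jn] ->; exact: nmin.
Qed.

Lemma first_hit_trace A z n w : first_hit A z (trace W n w) <->
  exists k, [/\ (k <= n)%N, hitting_time W A w = Some k & walk W k w = z].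
Proof. exact: first_hit_mkseq. Qed.

(** The probability of entering [A] at [z] by time [n], time [n] included, through first-step
    analysis. *)
Fixpoint hit_before A z (n : nat) (v : V) : R :=
  if v \in A then (v == z)%:R else
  if n is m.+1 then avg (hit_before A z m) v else 0.

Lemma expect_first_hit A z n v :
  expect N n (fun s => (first_hit A z s)%:R) v = hit_before A z n v.
Proof.
elim: n v => [|n ih] v /=.
  by rewrite /first_hit /=; case: ifP.
have [vA|vA] := boolP (v \in A).
  rewrite -[RHS](avg_cst N _ v); apply: eq_avg => y _.
  rewrite -[RHS](expect_cst N n _ y); apply: eq_expect => s.
  by rewrite /first_hit/= vA.
apply: eq_avg => y _; rewrite -ih; apply: eq_expect => s.
by rewrite /first_hit /= (negPf vA).
Qed.

Lemma hit_before_cvg A z v :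
  hit_before A z n v @[n --> \oo] --> hm A v z.
Proof.
have := walk_law_trace_cvg W v (@first_hit_rcons A z).
rewrite (_ : [set w | _] = [set w | exists2 n,
    hitting_time W A w = Some n & walk W n w = z]); last first.
  apply/seteqP; split => w /=.
    by move=> [n /first_hit_trace[k [_ hk kz]]]; exists k.
  by move=> [n hn nz]; exists n; apply/first_hit_trace; exists n.
under eq_cvg do rewrite expect_first_hit.
rewrite -[walk_law _ _ _]fineK; first exact: fine_cvg.
apply: fin_num_measure.
rewrite (_ : [set w | _] = \bigcup_n [set w | first_hit A z (trace W n w)]).
  by apply: bigcupT_measurable => n; exact: measurable_trace.
apply/seteqP; split => w /=.
  by move=> [n hn nz]; exists n => //; apply/first_hit_trace; exists n.
by move=> [n _ /first_hit_trace[k [_ hk kz]]]; exists k.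
Qed.

Arguments hit_before_cvg : clear implicits.

Lemma harmonic_measure_in A v z : v \in A -> hm A v z = (v == z)%:R.
Proof.
move=> vA; apply: (real_cvg_unique _ (hit_before_cvg A z v)).
rewrite (_ : hit_before A z ^~ v = fun=> (v == z)%:R); first exact: cvg_cst.
by apply/funext => -[|n] /=; rewrite vA.
Qed.

Lemma harmonic_measure_harmonic A v z : v \notin A ->
  avg (hm A ^~ z) v = hm A v z.
Proof.
move=> vA; apply: (real_cvg_unique _ (cvg_avg N v (hit_before_cvg A z))).
have := hit_before_cvg A z v; rewrite -(cvg_shiftn 1).
apply: cvg_trans; rewrite (_ : (fun n => hit_before A z (n + 1)%N v) =
  (fun n => avg (hit_before A z n) v))//.
by apply/funext => n; rewrite addn1/= (negPf vA).
Qed.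

Lemma hit_before_ge0 A z n v : 0 <= hit_before A z n v.
Proof.
by elim: n v => [|n ih] v /=; case: ifP => // _; exact: avg_ge0.
Qed.

Lemma hit_before_le1 A z n v : hit_before A z n v <= 1.
Proof.
elim: n v => [|n ih] v /=; case: ifP => // _; do ?by case: (_ == _).
by rewrite -(avg_cst N 1 v); apply: le_avg.
Qed.

Lemma harmonic_measure_ge0 A v z : 0 <= hm A v z.
Proof.
rewrite -(cvg_lim _ (hit_before_cvg A z v))//; apply: limr_ge.
  by apply: cvgP; exact: hit_before_cvg.
by near=> n; exact: hit_before_ge0.
Unshelve. all: by end_near. Qed.

Lemma harmonic_measure_le1 A v z : hm A v z <= 1.
Proof.
rewrite -(cvg_lim _ (hit_before_cvg A z v))//; apply: limr_le.
  by apply: cvgP; exact: hit_before_cvg.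
by near=> n; exact: hit_before_le1.
Unshelve. all: by end_near. Qed.

Context (Hrec : recurrent W).

(** Recurrence speaks of returns to the starting point: it says that the average of this function
    around [a] is 1. The function is then harmonic everywhere and attains its maximum 1 at [a], so
    it is constant. *)
Lemma harmonic_measure_point a v : hm [fset a]%fset v a = 1.
Proof.
have first_hit1 s : first_hit [fset a]%fset a s = (a \in s).
  rewrite /first_hit; elim: s => //= x s ih; rewrite !inE.
  by have [->|xa] := eqVneq x a; rewrite ?eqxx.
have avg1 : avg (hm [fset a]%fset ^~ a) a = 1.
  (* [behead] discards time 0, so that only returns at positive times count. *)
  have mono s x : a \in behead s -> a \in behead (rcons s x).
    by case: s => //= y s; rewrite mem_rcons inE orbC => ->.
  have := walk_law_trace_cvg W a mono.
  rewrite (_ : [set w | _] = [set w | exists2 n, (0 < n)%N & walk W n w = a]).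
    rewrite Hrec => /fine_cvg; rewrite -(cvg_shiftn 1) => c1.
    apply: (real_cvg_unique _ _ c1) => /=.
    apply: cvg_trans (cvg_avg N a (hit_before_cvg [fset a]%fset a)).
    rewrite (_ : (fun n => avg _ a) = (fun n => fine
      (expect N (n + 1) (fun s => (a \in behead s)%:R) a)%:E))//.
    apply/funext => n; rewrite addn1/=; apply: eq_avg => y _.
    by rewrite -expect_first_hit; apply: eq_expect => s; rewrite first_hit1.
  apply/seteqP; split => w /=.
    move=> [n]; rewrite /trace /= => /mapP[k]; rewrite mem_iota => /andP[k0 _] ->.
    by exists k.
  move=> [n n0 <-]; exists n; rewrite /trace /=; apply/mapP; exists n => //.
  by rewrite mem_iota n0 add1n ltnS leqnn.
apply: (@harmonic_attains_max _ _ N (hm [fset a]%fset ^~ a) 1 a).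
- by move=> y; exact: harmonic_measure_le1.
- move=> x; have [->|xa] := eqVneq x a; last first.
    by rewrite harmonic_measure_harmonic// inE.
  by rewrite avg1 harmonic_measure_in ?eqxx ?inE.
- by rewrite harmonic_measure_in ?eqxx ?inE.
Qed.

(** Iterating superharmonicity [n] times bounds [f] below by [- |M|] times the probability of not
    having hit [a] by time [n], which tends to 0 by recurrence. *)
Lemma min_principle_point (a : V) (f : V -> R) (M : R) :
  (forall v, - M <= f v) -> (forall v, v != a -> avg f v <= f v) ->
  0 <= f a -> forall v, 0 <= f v.
Proof.
move=> fM fsup fa v.
have fn n u : - `|M| * (1 - hit_before [fset a]%fset a n u) <= f u.
  have M0 : 0 <= `|M| by [].
  have MM := ler_norm M.
  elim: n u => [|n ih] u /=; rewrite inE; case: eqVneq => [->|ua].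
  - by rewrite subrr mulr0.
  - by have := fM u; lra.
  - by rewrite subrr mulr0.
  apply: le_trans (fsup _ ua).
  rewrite -[X in X - _](avg_cst N 1 u) -avgB -avgZ.
  by apply: le_avg => y _; exact: ih.
have : - `|M| * (1 - hit_before [fset a]%fset a n v) @[n --> \oo] --> (0 : R).
  rewrite -(mulr0 (- `|M|)) -(subrr 1); apply: cvgM; first exact: cvg_cst.
  apply: cvgB; first exact: cvg_cst.
  rewrite -(harmonic_measure_point a v); exact: hit_before_cvg.
move=> c; rewrite -(cvg_lim _ c)//; apply: limr_le; first exact: cvgP c.
by near=> n; exact: fn.
Unshelve. all: by end_near. Qed.

(* Replacing [f] by [min f 0], which is superharmonic on [A] as well, reduces
   to the case of a point. *)
Lemma min_principle A (f : V -> R) (M : R) : A != fset0 ->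
  (forall v, - M <= f v) -> (forall v, v \notin A -> avg f v <= f v) ->
  (forall v, v \in A -> 0 <= f v) -> forall v, 0 <= f v.
Proof.
move=> /fset0Pn[a aA] fM fsup fA v.
suff : 0 <= Num.min (f v) 0 by rewrite le_min => /andP[].
apply: (@min_principle_point a (fun u => Num.min (f u) 0) `|M|).
- move=> u; rewrite le_min oppr_le0 normr_ge0 andbT.
  by apply: le_trans (fM u); rewrite lerN2 ler_norm.
- move=> u _; rewrite le_min; apply/andP; split.
    have [uA|uA] := boolP (u \in A).
      apply: le_trans (fA _ uA); rewrite -[leRHS](avg_cst N 0 u).
      by apply: le_avg => y _; rewrite ge_min lexx orbT.
    by apply: le_trans (fsup _ uA); apply: le_avg => y _; rewrite ge_min lexx.
  rewrite -[leRHS](avg_cst N 0 u).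
  by apply: le_avg => y _; rewrite ge_min lexx orbT.
- by rewrite le_min fA/=.
Qed.

(** The minimum principle applies to both differences. Comparing [avg f - f] with [avg g - g],
    instead of asking for harmonicity, covers functions with equal nonzero Laplacians. *)
Lemma bounded_harmonic_eq A (f g : V -> R) (M M' : R) : A != fset0 ->
  (forall v, `|f v| <= M) -> (forall v, `|g v| <= M') ->
  (forall v, v \notin A -> avg f v - f v = avg g v - g v) ->
  (forall v, v \in A -> f v = g v) -> forall v, f v = g v.
Proof.
move=> A0 fM gM fg fgA v; apply/eqP; rewrite eq_le -subr_ge0 -[g v <= f v]subr_ge0.
have bnd u : - (M + M') <= f u - g u <= M + M'.
  have := fM u; have := gM u; rewrite !ler_norml => /andP[? ?] /andP[? ?].
  by apply/andP; split; lra.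
apply/andP; split.
- apply: (min_principle A0 (f := fun u => g u - f u) (M := M + M')).
  + by move=> u; case/andP: (bnd u) => *; lra.
  + by move=> u /fg; rewrite avgB => *; lra.
  + by move=> u /fgA ->; rewrite subrr.
- apply: (min_principle A0 (f := fun u => f u - g u) (M := M + M')).
  + by move=> u; case/andP: (bnd u) => *; lra.
  + by move=> u /fg; rewrite avgB => *; lra.
  + by move=> u /fgA ->; rewrite subrr.
Qed.

Lemma harmonic_measure_norm_le1 A v z : `|hm A v z| <= 1.
Proof. by rewrite ger0_norm ?harmonic_measure_le1 ?harmonic_measure_ge0. Qed.

Lemma harmonic_measure_sum A v : A != fset0 -> \sum_(z <- A) hm A v z = 1.
Proof.
move=> A0.
apply: (@bounded_harmonic_eq A (fun u => \sum_(z <- A) hm A u z) (fun=> 1)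
  (\sum_(z <- A) 1) 1) => //.
- move=> u; apply: le_trans (ler_norm_sum _ _ _) _.
  by apply: ler_sum => z _; exact: harmonic_measure_norm_le1.
- by move=> u; rewrite normr1.
- move=> u uA; rewrite avg_cst subrr avg_sum.
  by rewrite (eq_bigr _ (fun z _ => harmonic_measure_harmonic z uA)) subrr.
- move=> u uA; rewrite (bigD1_seq u) ?fset_uniq//= harmonic_measure_in// eqxx.
  rewrite big1 ?addr0// => z; rewrite harmonic_measure_in// eq_sym.
  by move=> /negPf->.
Qed.

End HarmonicMeasure.

Arguments hit_before_cvg {R V N d Omega} W A z v.

(** * The Green density *)

Section Green.
Context {R : realType} {V : choiceType} (N : network R V).
Context {d} {Omega : measurableType d} (W : network_walk N Omega).
Implicit Types (A : {fset V}).
Local Notation avg := (avg N).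
Local Notation hm := (harmonic_measure W).
Local Notation tc := (total_cond N).

(** The probability, from [x], of being at [y] at time [n] with [o] not visited up to time [n]. *)
Fixpoint killed (o y : V) (n : nat) (x : V) : R :=
  if x == o then 0 else
  if n is m.+1 then avg (killed o y m) x else (x == y)%:R.

Lemma expect_killed o y n x :
  expect N n (fun s => ((o \notin s) && (nth o s n == y))%:R) x =
  killed o y n x.
Proof.
elim: n x => [|n ih] x /=; first by rewrite inE eq_sym; case: eqP.
have [->|xo] := eqVneq x o.
  rewrite -[RHS](avg_cst N 0 o); apply: eq_avg => z _.
  rewrite -[RHS](expect_cst N n 0 z); apply: eq_expect => s.
  by rewrite inE eqxx.
apply: eq_avg => z _; rewrite -ih; apply: eq_expect => s.
by rewrite inE eq_sym (negPf xo).
Qed.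

Lemma walk_law_killed o y n x :
  walk_law W x [set w | walk W n w = y /\ hits_after W [fset o]%fset n w] =
  (killed o y n x)%:E.
Proof.
rewrite -expect_killed -(walk_law_trace W); congr (walk_law W x _).
have avoidP w : hits_after W [fset o]%fset n w <-> o \notin trace W n w.
  rewrite /hits_after; case E : hitting_time => [k|]; last first.
    split=> // _; apply/negP => /mapP[j _ oj].
    by have := hitting_time_None E j; rewrite -oj inE eqxx.
  have [ko kmin] := (hitting_timeP W _ _ _).1 E; split=> [nk|].
    apply/negP => /mapP[j]; rewrite mem_iota add0n ltnS => /= jn oj.
    have := kmin j (leq_ltn_trans jn nk).
    by rewrite -oj inE eqxx.
  apply: contraR; rewrite -leqNgt => kn; apply/mapP; exists k.
    by rewrite mem_iota.
  by move: ko; rewrite inE => /eqP.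
apply/seteqP; split => w /=; rewrite /trace nth_mkseq//.
  by move=> [-> /avoidP->]/=; rewrite eqxx.
by move=> /andP[/avoidP wo /eqP].
Qed.

Lemma killed_ge0 o y n x : 0 <= killed o y n x.
Proof. by elim: n x => [|n ih] x /=; case: ifP => // _; exact: avg_ge0. Qed.

Lemma killed_root o y n : killed o y n o = 0.
Proof. by case: n => [|n] /=; rewrite eqxx. Qed.

Lemma killed_at_root o n x : killed o o n x = 0.
Proof.
elim: n x => [|n ih] x /=; case: eqP => // _.
by rewrite -[RHS](avg_cst N 0 x); apply: eq_avg.
Qed.

Lemma killed_sumS o y n x : x != o ->
  \sum_(0 <= k < n.+1) killed o y k x =
  (x == y)%:R + avg (fun z => \sum_(0 <= k < n) killed o y k z) x.
Proof.
by move=> xo; rewrite big_nat_recl//= (negPf xo) avg_sum.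
Qed.

Lemma nbrs_sum_eq x y :
  \sum_(w <- nbrs N y) (x == w)%:R * transition N w y = transition N x y.
Proof.
have [xy|nxy] := boolP (x \in nbrs N y).
  rewrite (bigD1_seq x) ?nbrs_uniq//= eqxx mul1r big1 ?addr0// => z.
  by rewrite eq_sym => /negPf->; rewrite mul0r.
rewrite big_seq big1 => [|z zy].
  by move: nxy; rewrite mem_nbrs adj_sym /transition => /negPf->.
case: eqP => [xz|]; last by rewrite mul0r.
by rewrite xz zy in nxy.
Qed.

(** The probability of avoiding [o] up to time [n] and then jumping to [y]. For [y] other than [o]
    this is the killed kernel at time [n.+1]; for [y] equal to [o] it is the probability of first
    hitting [o] at time [n.+1]. *)
Definition last_step o y n x : R :=
  \sum_(w <- nbrs N y) killed o w n x * transition N w y.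

Lemma last_step0 o y x : x != o -> last_step o y 0 x = transition N x y.
Proof. by move=> xo; rewrite /last_step/= (negPf xo) nbrs_sum_eq. Qed.

Lemma last_stepS o y n x : x != o ->
  last_step o y n.+1 x = avg (last_step o y n) x.
Proof.
move=> xo; rewrite /last_step/= (negPf xo) avg_sum.
by apply: eq_bigr => w _; rewrite mulrC -avgZ; apply: eq_avg => z _; exact: mulrC.
Qed.

Lemma last_step_root o y n : last_step o y n o = 0.
Proof. by rewrite /last_step big1// => w _; rewrite killed_root mul0r. Qed.

Lemma killed_last o y n x : y != o -> killed o y n.+1 x = last_step o y n x.
Proof.
move=> yo; elim: n x => [|n ih] x; have [->|xo] := eqVneq x o.
- by rewrite killed_root last_step_root.
- rewrite last_step0// -avg_eq /= (negPf xo); apply: eq_avg => z _.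
  by have [->|] := eqVneq z o; rewrite // eq_sym (negPf yo).
- by rewrite killed_root last_step_root.
- rewrite last_stepS// -[LHS]/(if x == o then 0 else avg (killed o y n.+1) x).
  by rewrite (negPf xo); apply: eq_avg => z _.
Qed.

Lemma hit_before_last o n x :
  hit_before N [fset o]%fset o n.+1 x - hit_before N [fset o]%fset o n x =
  last_step o o n x.
Proof.
have hbS m z : hit_before N [fset o]%fset o m.+1 z =
    if z == o then 1 else avg (hit_before N [fset o]%fset o m) z.
  by rewrite /= inE; case: eqP.
elim: n x => [|n ih] x; have [->|xo] := eqVneq x o.
- by rewrite /= inE eqxx last_step_root subrr.
- rewrite last_step0// hbS (negPf xo) /= inE (negPf xo) subr0 -avg_eq.
  by apply: eq_avg => z _; rewrite inE; case: eqP.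
- by rewrite !hbS eqxx last_step_root subrr.
- rewrite last_stepS// !(hbS _ x) (negPf xo) -avgB.
  by apply: eq_avg => z _; exact: ih.
Qed.

(** A first-step decomposition on one side and a last-step decomposition on the other are matched
    term by term by detailed balance. *)
Lemma killed_reversible o x y n : tc x * killed o y n x = tc y * killed o x n y.
Proof.
elim: n x y => [|n ih] x y.
  rewrite /=; have [->//|xy] := eqVneq x y.
  by do 2 case: ifP => _; rewrite ?mulr0.
have [->|xo] := eqVneq x o; first by rewrite killed_root killed_at_root !mulr0.
rewrite (killed_last _ _ xo) /= (negPf xo) /avg /last_step !mulr_sumr.
apply: eq_bigr => w _; rewrite mulrA transition_reversible mulrA -ih.
by rewrite mulrAC.
Qed.

Context (Hrec : recurrent W).

(** If the walk from [y] were certain to return to [y] before [o], the hitting probability would be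
    bounded, harmonic off [o] and 0 at [o], hence identically 0, although it is 1 at [y]. *)
Lemma avg_hit_lt1 o y : y != o -> avg (hm [fset o; y]%fset ^~ y) y < 1.
Proof.
move=> yo; rewrite lt_neqAle; apply/andP; split; last first.
  by rewrite -[leRHS](avg_cst N 1 y); apply: le_avg => z _;
    exact: harmonic_measure_le1.
apply/eqP => h1.
have hyy : hm [fset o; y]%fset y y = 1.
  by rewrite harmonic_measure_in ?eqxx// !inE eqxx orbT.
suff : hm [fset o; y]%fset y y = 0 by rewrite hyy => /eqP; rewrite oner_eq0.
apply: (@bounded_harmonic_eq _ _ N _ _ W Hrec [fset o]%fset
  (hm [fset o; y]%fset ^~ y) (fun=> 0) 1 0).
- by apply/fset0Pn; exists o; rewrite inE.
- by move=> v; exact: harmonic_measure_norm_le1.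
- by move=> v; rewrite normr0.
- move=> v; rewrite inE => vo; rewrite avg_cst subrr.
  have [->|vy] := eqVneq v y; first by rewrite h1 hyy subrr.
  by rewrite harmonic_measure_harmonic ?subrr// !inE negb_or vo.
- move=> v; rewrite inE => /eqP->; rewrite harmonic_measure_in ?inE ?eqxx//.
  by rewrite eq_sym (negPf yo).
Qed.

(** With [e] the probability of escaping from [y] to [o], the function [e^-1 * f] is harmonic off
    [o] and [y], and its average at [y] lies 1 below its value there. It therefore dominates the
    recursion for the partial sums. *)
Lemma killed_sum_bounded o y :
  exists M, forall n x, \sum_(0 <= k < n) killed o y k x <= M.
Proof.
have [->|yo] := eqVneq y o.
  by exists 0 => n x; rewrite big1// => k _; rewrite killed_at_root.
set f := hm [fset o; y]%fset ^~ y; set e := 1 - avg f y.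
have e0 : 0 < e by rewrite subr_gt0 avg_hit_lt1.
suff bnd n x : \sum_(0 <= k < n) killed o y k x <= e^-1 * f x.
  exists e^-1 => n x; apply: le_trans (bnd n x) _.
  by rewrite ler_piMr ?invr_ge0 ?(ltW e0)//; exact: harmonic_measure_le1.
have F0 z : 0 <= e^-1 * f z.
  by rewrite mulr_ge0 ?invr_ge0 ?(ltW e0)//; exact: harmonic_measure_ge0.
elim: n x => [|n ih] x; first by rewrite big_geq.
have [->|xo] := eqVneq x o; first by rewrite big1// => k _; rewrite killed_root.
rewrite killed_sumS//.
apply: (@le_trans _ _ ((x == y)%:R + avg (fun z => e^-1 * f z) x)).
  by rewrite lerD2l; apply: le_avg => z _; exact: ih.
rewrite avgZ; have [->|xy] := eqVneq x y.
  rewrite /f harmonic_measure_in ?inE ?eqxx ?orbT// mulr1 -/f.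
  rewrite -(ler_pM2l e0) mulrDr mulr1 mulrA divff ?gt_eqF// mul1r /e.
  by rewrite subrK.
by rewrite add0r /f harmonic_measure_harmonic// !inE negb_or xo.
Qed.

(** The bound on the partial sums makes [fine] in [green] harmless: the extended series is a real
    limit. *)
Lemma green_series o x y :
  \sum_(0 <= k < n) killed o y k x @[n --> \oo] --> tc y * green W o x y.
Proof.
set u := (fun n => \sum_(0 <= k < n) killed o y k x).
have cu : cvgn u.
  apply: nondecreasing_is_cvgn.
    apply/nondecreasing_seqP => n; rewrite /u big_nat_recr//= lerDl.
    exact: killed_ge0.
  by have [M uM] := killed_sum_bounded o y; exists M => _ [n _ <-]; exact: uM.
suff -> : tc y * green W o x y = limn u by [].
rewrite /green; under eq_eseriesr do rewrite walk_law_killed.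
rewrite (_ : (\sum_(0 <= n <oo) _)%E = (limn u)%:E) -?EFinM /=.
  by rewrite mulrA divff ?mul1r// gt_eqF// total_cond_gt0.
rewrite -EFin_lim//; congr (limn _); apply/funext => n.
by rewrite sumEFin.
Qed.

Arguments green_series : clear implicits.

Lemma green_root o y : green W o o y = 0.
Proof.
apply: (mulfI (lt0r_neq0 (total_cond_gt0 N y))); rewrite mulr0.
apply: (real_cvg_unique _ (green_series o o y)).
rewrite (_ : (fun n => _) = fun=> 0); first exact: cvg_cst.
by apply/funext => n; rewrite big1// => k _; rewrite killed_root.
Qed.

Lemma green_sym o x y : green W o x y = green W o y x.
Proof.
apply: (mulfI (lt0r_neq0 (total_cond_gt0 N y))).
apply: (mulfI (lt0r_neq0 (total_cond_gt0 N x))); rewrite [RHS]mulrCA.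
have c u v : tc u * \sum_(0 <= k < n) killed o v k u @[n --> \oo] -->
    tc u * (tc v * green W o u v).
  by apply: cvgM; [exact: cvg_cst|exact: green_series].
apply: (real_cvg_unique _ (c x y)).
rewrite (_ : (fun n => _) = fun n => tc y * \sum_(0 <= k < n) killed o x k y).
  exact: c.
apply/funext => n; rewrite !mulr_sumr.
by apply: eq_bigr => k _; exact: killed_reversible.
Qed.

Lemma green_ge0 o x y : 0 <= green W o x y.
Proof.
rewrite -(pmulr_rge0 _ (total_cond_gt0 N y)).
rewrite -(cvg_lim _ (green_series o x y))//; apply: limr_ge.
  exact: (cvgP _ (green_series o x y)).
by near=> n; apply: sumr_ge0 => k _; exact: killed_ge0.
Unshelve. all: by end_near. Qed.

Lemma green_bounded o y : exists M, forall x, `|green W o x y| <= M.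
Proof.
have [M uM] := killed_sum_bounded o y; exists ((tc y)^-1 * M) => x.
rewrite ger0_norm ?green_ge0//.
rewrite -(ler_pM2l (total_cond_gt0 N y)) mulrA divff ?gt_eqF ?total_cond_gt0//.
rewrite mul1r -(cvg_lim _ (green_series o x y))//; apply: limr_le.
  exact: (cvgP _ (green_series o x y)).
by near=> n; exact: uM.
Unshelve. all: by end_near. Qed.

(** Limit of the first-step recursion for the killed sums; the right-hand side accounts for the
    visit at time 0. *)
Lemma green_avg o x y : x != o ->
  tc y * (avg (green W o ^~ y) x - green W o x y) = - (x == y)%:R.
Proof.
move=> xo; rewrite mulrBr; apply/eqP; rewrite subr_eq addrC -subr_eq opprK.
rewrite addrC -avgZ eq_sym; apply/eqP.
have := green_series o x y; rewrite -(cvg_shiftn 1) => c.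
apply: (real_cvg_unique _ c) => /=.
apply: cvg_trans (cvgD (cvg_cst ((x == y)%:R : R))
  (cvg_avg N x (fun z => green_series o z y))).
rewrite (_ : (fun n => \sum_(0 <= k < n + 1) _) = (fun n =>
  (x == y)%:R + avg (fun z => \sum_(0 <= k < n) killed o y k z) x))//.
by apply/funext => n; rewrite addn1 killed_sumS.
Qed.

Lemma green_laplacian o x y : x != o ->
  laplacian N (green W o ^~ y) x = - (x == y)%:R.
Proof.
move=> xo; rewrite laplacianE; have := green_avg y xo.
have [->//|xy] := eqVneq x y.
rewrite oppr0 => /eqP; rewrite mulf_eq0 gt_eqF ?total_cond_gt0//= => /eqP->.
by rewrite mulr0.
Qed.

(** By symmetry and detailed balance, the Laplacian at [o] is the sum over all times of the
    probability, from [y], of first hitting [o] at that time. The total is 1 by recurrence. *)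
Lemma green_laplacian_root o y : y != o -> laplacian N (green W o ^~ y) o = 1.
Proof.
move=> yo; rewrite laplacianE green_root subr0 /avg mulr_sumr.
have c := hit_before_cvg W [fset o]%fset o y.
rewrite harmonic_measure_point// in c.
apply: (real_cvg_unique _ _ c).
have cl : \sum_(w <- nbrs N o) transition N w o *
    (\sum_(0 <= k < n) killed o w k y) @[n --> \oo] -->
    \sum_(w <- nbrs N o) tc o * (transition N o w * green W o w y).
  apply: cvg_big; first exact: add_continuous.
  move=> w _; rewrite mulrA transition_reversible (mulrC (tc w)) -mulrA green_sym.
  by apply: cvgM; [exact: cvg_cst|exact: green_series].
apply: cvg_trans cl; rewrite (_ : hit_before _ _ _ ^~ _ = fun n =>
  \sum_(w <- nbrs N o) transition N w o * (\sum_(0 <= k < n) killed o w k y))//.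
apply/funext => n; under eq_bigr do rewrite mulr_sumr.
rewrite exchange_big/= (eq_bigr (fun k => last_step o o k y)); last first.
  by move=> k _; apply: eq_bigr => w _; rewrite mulrC.
rewrite (eq_bigr (fun k => hit_before N [fset o]%fset o k.+1 y -
  hit_before N [fset o]%fset o k y)); last first.
  by move=> k _; rewrite hit_before_last.
(* The value of [hit_before] at time 0 is 0 because [y] differs from [o]. *)
by rewrite telescope_sumr//= [X in _ - X]/= inE (negPf yo) subr0.
Qed.

Lemma green_diag_gt0 o y : y != o -> 0 < green W o y y.
Proof.
move=> yo; have := green_avg y yo; rewrite eqxx => e.
have : 0 <= tc y * avg (green W o ^~ y) y.
  rewrite mulr_ge0 ?(ltW (total_cond_gt0 N y))//.
  by apply: avg_ge0 => x; exact: green_ge0.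
rewrite -(pmulr_rgt0 _ (total_cond_gt0 N y)); move: e; rewrite mulrBr /=; lra.
Qed.

(** Both sides are bounded, harmonic off [o] and [y], and agree at these two vertices. This links
    limits of Green densities to two-point harmonic measures. *)
Lemma green_hit o x y :
  green W o x y = hm [fset o; y]%fset x y * green W o y y.
Proof.
have [->|yo] := eqVneq y o.
  by rewrite !(green_sym o _ o) !green_root mulr0.
have [M gM] := green_bounded o y.
apply: (@bounded_harmonic_eq _ _ N _ _ W Hrec [fset o; y]%fset
  (green W o ^~ y) (fun x => hm [fset o; y]%fset x y * green W o y y)
  M (1 * M)) => //.
- by apply/fset0Pn; exists o; rewrite !inE eqxx.
- move=> v; rewrite normrM ler_pM//; exact: harmonic_measure_norm_le1.
- move=> v vA; move: (vA); rewrite !inE negb_or => /andP[vo vy].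
  have := green_avg y vo; rewrite (negPf vy) oppr0 => /eqP.
  rewrite mulf_eq0 gt_eqF ?total_cond_gt0//= => /eqP->.
  rewrite (@eq_avg _ _ _ _ (fun x => green W o y y * hm [fset o; y]%fset x y)).
    by rewrite avgZ harmonic_measure_harmonic// mulrC subrr.
  by move=> z _; rewrite mulrC.
- move=> v vA; rewrite harmonic_measure_in//; move: vA; rewrite !inE.
  move=> /orP[] /eqP->; last by rewrite eqxx mul1r.
  by rewrite green_root eq_sym (negPf yo) mul0r.
Qed.

Lemma green_le_diag o x y : green W o x y <= green W o y y.
Proof.
by rewrite green_hit ler_piMl ?green_ge0// harmonic_measure_le1.
Qed.

End Green.

Arguments green_series {R V N d Omega W} Hrec o x y.

(** * Potentials as limits of Green densities *)

(** Compactness gives a cluster point, and an ultrafilter converges to its cluster points. *)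
Lemma ultrafilter_cvg_segment (R : realType) (I : Type) (U : set_system I)
    (UU : UltraFilter U) (a b : R) (u : I -> R) :
  (forall i, u i \in `[a, b]) -> exists l : R, u i @[i --> U] --> l.
Proof.
move=> uab.
have [|l [_ ul]] := @segment_compact R a b (u @ U) _.
  by apply: (@filterE _ U) => i; exact: uab.
exists l => B lB; have [//|UB] := in_ultra_setVsetC (u @^-1` B) UU.
by have [x [/= nBx]] := ul (~` B) B UB lB.
Qed.

Section Laplacian.
Context {R : realType} {V : choiceType} (N : network R V).
Local Notation lap := (laplacian N).

Lemma laplacian_eq0 f v : lap f v = 0 <-> avg N f v = f v.
Proof.
rewrite laplacianE; split => [/eqP|->]; last by rewrite subrr mulr0.
by rewrite mulf_eq0 gt_eqF ?total_cond_gt0//= subr_eq0 => /eqP.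
Qed.

Lemma laplacian_inj f g v : lap f v = lap g v ->
  avg N f v - f v = avg N g v - g v.
Proof.
by rewrite !laplacianE => /(mulfI (lt0r_neq0 (total_cond_gt0 N v))).
Qed.

Lemma laplacianD f g v : lap (fun x => f x + g x) v = lap f v + lap g v.
Proof. by rewrite !laplacianE avgD; ring. Qed.

Lemma laplacian_cst a v : lap (fun=> a) v = 0.
Proof. by apply/laplacian_eq0; rewrite avg_cst. Qed.

Lemma laplacian_lin (I : Type) (r : seq I) (a : I -> R) (F : I -> V -> R) v :
  lap (fun x => \sum_(i <- r) a i * F i x) v = \sum_(i <- r) a i * lap (F i) v.
Proof.
rewrite laplacianE avg_sum -sumrB mulr_sumr; apply: eq_bigr => i _.
by rewrite avgZ -mulrBr mulrCA laplacianE.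
Qed.

Lemma cvg_laplacian (I : Type) (F : set_system I) (FF : Filter F)
    (f : I -> V -> R) (g : V -> R) v :
  (forall y, f i y @[i --> F] --> g y) -> lap (f i) v @[i --> F] --> lap g v.
Proof.
move=> fg; under eq_cvg do rewrite laplacianE; rewrite laplacianE.
apply: cvgM; first exact: cvg_cst.
by apply: cvgB; [exact: cvg_avg|exact: fg].
Qed.

Lemma vertex_infty_proper : ProperFilter (@vertex_infty V).
Proof. exact: frechet_properfilter (vertices_infinite N). Qed.

Lemma vertex_infty_neq (x : V) : @vertex_infty V [set v | v != x].
Proof.
apply: (@sub_finite_set _ _ [set x]) => // v /= /negP.
by rewrite negbK => /eqP.
Qed.

End Laplacian.

Arguments cvg_laplacian {R V} N {I F FF f g} v _.

(** * Representation of bounded functions and potentials by Green densities *)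

Section Representation.
Context {R : realType} {V : choiceType} (N : network R V).
Context {d} {Omega : measurableType d} (W : network_walk N Omega).
Context (Hrec : recurrent W).
Implicit Types (A K : {fset V}) (o : V).
Local Notation lap := (laplacian N).
Local Notation hm := (harmonic_measure W).

Lemma bounded_laplacian_eq A (f g : V -> R) (M M' : R) : A != fset0 ->
  (forall v, `|f v| <= M) -> (forall v, `|g v| <= M') ->
  (forall v, v \notin A -> lap f v = lap g v) ->
  (forall v, v \in A -> f v = g v) -> forall v, f v = g v.
Proof.
move=> A0 fM gM fg; apply: (bounded_harmonic_eq Hrec A0 fM gM) => v /fg.
exact: laplacian_inj.
Qed.

Lemma fset1_neq0 (o : V) : [fset o]%fset != fset0.
Proof. by apply/fset0Pn; exists o; rewrite inE. Qed.

Lemma green_sum_laplacian o K (mu : V -> R) v : v != o ->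
  lap (fun x => \sum_(y <- (K `\ o)%fset) mu y * green W o x y) v =
  if v \in K then - mu v else 0.
Proof.
move=> vo; rewrite laplacian_lin.
under eq_bigr do rewrite green_laplacian//.
case: ifPn => vK.
  rewrite (bigD1_seq v) ?fset_uniq//= ?inE ?vo// eqxx mulrN1 big1 ?addr0// => y.
  by rewrite eq_sym => /negPf->; rewrite oppr0 mulr0.
rewrite big_seq big1// => y; rewrite !inE => /andP[_ yK].
case: eqP => [vy|]; last by rewrite oppr0 mulr0.
by rewrite vy yK in vK.
Qed.

Lemma green_decomposition o K (f : V -> R) (M : R) :
  (forall v, `|f v| <= M) -> f o = 0 ->
  (forall v, v \notin K -> v != o -> lap f v = 0) ->
  forall x, f x = \sum_(y <- (K `\ o)%fset) - lap f y * green W o x y.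
Proof.
move=> fM fo fK.
have /choice[B gB] := green_bounded Hrec o.
apply: (bounded_laplacian_eq (fset1_neq0 o) fM
  (M' := \sum_(y <- (K `\ o)%fset) `|lap f y| * B y)).
- move=> v; apply: le_trans (ler_norm_sum _ _ _) _; apply: ler_sum => y _.
  by rewrite normrM normrN ler_wpM2l.
- move=> v; rewrite inE => vo; rewrite green_sum_laplacian// opprK.
  by case: ifPn => // vK; rewrite fK.
- move=> v; rewrite inE => /eqP->; rewrite fo big1// => y _.
  by rewrite green_root// mulr0.
Qed.

(** Laplacians are finite sums, so they pass to the limit. The Laplacian of [green W o ^~ v] has the
    required value at [x] as soon as [v] differs from [x], which holds eventually along [F]. *)
Lemma green_limit_potential o (F : set_system V) (k : V -> R) :
  ProperFilter F -> @vertex_infty V `<=` F ->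
  (forall y, green W o y v @[v --> F] --> k y) -> potential N o k.
Proof.
move=> FF iF gk.
have limE (u : V -> R) (a b : R) (x : V) : u v @[v --> F] --> a ->
    (forall v, v != x -> u v = b) -> a = b.
  move=> ua ub; apply: (real_cvg_unique _ ua).
  apply: cvg_near_cst; apply: (filterS _ (iF _ (vertex_infty_neq x))) => v.
  exact: ub.
split.
- move=> y; rewrite -(cvg_lim _ (gk y))//; apply: limr_ge.
    exact: cvgP (gk y).
  by apply: nearW => v; exact: green_ge0.
- apply: (limE _ _ _ o (gk o)) => v _; exact: green_root.
- apply: (limE _ _ _ o (cvg_laplacian N o gk)) => v vo.
  exact: green_laplacian_root.
- move=> x xo; apply: (limE _ _ _ x (cvg_laplacian N x gk)) => v vx.
  by rewrite green_laplacian// eq_sym (negPf vx) oppr0.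
Qed.


(** The weights are minus the Laplacian of [f], the bounded harmonic extension of [h] from [K].
    Where all neighbours lie in [K], the Laplacians of [f] and [h] coincide. *)
Lemma potential_representation o (h : V -> R) K : potential N o h -> o \in K ->
  {subset nbrs N o <= K} ->
  exists mu : V -> R, [/\ forall b, b \in (K `\ o)%fset -> 0 <= mu b,
    forall b, b != o -> b \in K -> {subset nbrs N b <= K} -> mu b = 0,
    \sum_(b <- (K `\ o)%fset) mu b = 1 &
    forall x, x \in K -> h x = \sum_(b <- (K `\ o)%fset) mu b * green W o x b].
Proof.
move=> [h0 ho h1 hh] oK onK.
pose f x := \sum_(b <- K) h b * hm K x b.
have K0 : K != fset0 by apply/fset0Pn; exists o.
have fK x : x \in K -> f x = h x.
  move=> xK; rewrite /f (bigD1_seq x) ?fset_uniq//= harmonic_measure_in//.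
  rewrite eqxx mulr1 big1 ?addr0// => b; rewrite harmonic_measure_in// eq_sym.
  by move=> /negPf->; rewrite mulr0.
have fharm x : x \notin K -> lap f x = 0.
  move=> xK; rewrite laplacian_lin big1// => b _.
  by rewrite (laplacian_eq0 N _ x).2 ?mulr0// harmonic_measure_harmonic.
have fB x : `|f x| <= \sum_(b <- K) h b * 1.
  apply: le_trans (ler_norm_sum _ _ _) _; apply: ler_sum => b _.
  rewrite normrM (ger0_norm (h0 b)) ler_wpM2l//.
  exact: harmonic_measure_norm_le1.
have fh x : f x <= h x.
  rewrite -subr_ge0; move: x.
  (* As [h] is nonnegative, the upper bound on [f] bounds [h - f] below. *)
  apply: (min_principle Hrec K0 (M := \sum_(b <- K) h b * 1)).
  - move=> x; have := fB x; rewrite ler_norml => /andP[_ ?].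
    by have := h0 x; lra.
  - move=> x xK; have xo : x != o by apply: contraNneq xK => ->.
    rewrite avgB (laplacian_eq0 N _ x).1 ?hh//.
    by rewrite (laplacian_eq0 N _ x).1 ?fharm.
  - by move=> x /fK->; rewrite subrr.
have lapf x : x \in K -> lap f x <= lap h x.
  move=> xK; rewrite !laplacianE fK//.
  by rewrite ler_pM2l ?total_cond_gt0// lerD2r; apply: le_avg.
have lapfE x : x \in K -> {subset nbrs N x <= K} -> lap f x = lap h x.
  move=> xK nK; rewrite !laplacianE fK//; congr (_ * (_ - _)).
  by apply: eq_avg => y xy; apply: fK; apply: nK; rewrite mem_nbrs.
have fo : f o = 0 by rewrite fK.
have fE := green_decomposition fB fo (fun v vK _ => fharm v vK).
exists (fun b => - lap f b); split.
- move=> b; rewrite !inE => /andP[bo bK]; rewrite oppr_ge0.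
  by rewrite -(hh _ bo); exact: lapf.
- by move=> b bo bK nK; rewrite lapfE// hh// oppr0.
(* Each Green density has Laplacian 1 at [o], so the total weight is the Laplacian of [f], hence of
   [h], at [o]. *)
- rewrite -h1 -lapfE// (funext fE) laplacian_lin big_seq [RHS]big_seq.
  apply: eq_bigr => b; rewrite !inE => /andP[bo _].
  by rewrite -(funext fE) green_laplacian_root// mulr1.
- by move=> x xK; rewrite -fE fK.
Qed.

(* Far from [x], the representation exhibits [h x] as a convex combination of
   the values [green W o x b] with [b] far away. *)
Lemma potential_green_limit o (h : V -> R) (x : V) (k : R) : potential N o h ->
  green W o x v @[v --> @vertex_infty V] --> k -> h x = k.
Proof.
move=> hpot gk; apply/eqP; rewrite -subr_eq0 -normr_le0.
apply/ler_addgt0Pl => e e0; rewrite addr0.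
have : @vertex_infty V [set v | `|k - green W o x v| < e].
  have FF := vertex_infty_proper N.
  by move/cvgrPdist_lt: gk; apply.
move=> finB.
(* Finitely many vertices are bad. Since [K] contains all neighbours of [B], the weights on [B] off
   [o] vanish and only good vertices carry mass. *)
pose bad := ~` [set v | `|k - green W o x v| < e].
pose B := (o |` (x |` fset_set bad))%fset.
pose K := (B `|` [fset y in flatten [seq nbrs N b | b <- B]])%fset.
have BK b : b \in B -> b \in K by move=> bB; rewrite inE bB.
have nBK b : b \in B -> {subset nbrs N b <= K}.
  move=> bB y yb; rewrite !inE; apply/orP; right.
  by apply/flattenP; exists (nbrs N b) => //; apply: map_f.
have oB : o \in B by rewrite !inE eqxx.
have xB : x \in B by rewrite !inE eqxx orbT.
have [mu [mu0 muB mu1 hE]] := potential_representation hpot (BK _ oB) (nBK _ oB).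
rewrite (hE _ (BK _ xB)) -[k]mul1r -mu1 mulr_suml -sumrB.
apply: le_trans (ler_norm_sum _ _ _) _.
rewrite -[e]mul1r -mu1 mulr_suml big_seq [leRHS]big_seq.
apply: ler_sum => b bK; have := bK; rewrite 2!inE => /andP[bo bK'].
rewrite -mulrBr normrM (ger0_norm (mu0 _ bK)).
have [bB|bB] := boolP (b \in B).
  by rewrite muB ?mul0r//; exact: nBK.
apply: ler_wpM2l; first exact: mu0.
rewrite distrC ltW//; move: bB; rewrite !inE !negb_or => /and3P[_ _].
rewrite in_fset_set//; rewrite notin_setE /= => /contrapT.
exact.
Qed.

(** If convergence failed, the set of [v] with [green W o x v] at distance at least [e] from [h x]
    would meet every cofinite set. Along an ultrafilter containing it and finer than infinity, all
    Green densities converge at once, to a potential different from [h]. *)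
Lemma unique_potential_green_limit o (h : V -> R) (x : V) :
  unique (potential N o) h -> green W o x v @[v --> @vertex_infty V] --> h x.
Proof.
move=> [hpot huniq]; have FF := vertex_infty_proper N.
apply/cvgrPdist_lt => e e0; apply: contrapT => nF.
pose D := [set v | ~ `|h x - green W o x v| < e].
have FD : ProperFilter (within D (@vertex_infty V)).
  split; last exact: within_filter.
  move=> D0; apply: nF.
  apply: (filterS _ (D0 : vertex_infty [set v | D v -> set0 v])) => v /= Dv.
  exact: contrapT.
have [U [UU DU]] := ultraFilterLemma FD.
have iU : @vertex_infty V `<=` U.
  by move=> P VP; apply: DU; exact: (filterS _ (VP : vertex_infty P)).
have gU y : exists l, green W o y v @[v --> U] --> (l : R).
  apply: (@ultrafilter_cvg_segment _ _ _ UU 0 (green W o y y)) => v.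
  by rewrite in_itv/= green_ge0// green_sym// green_le_diag.
have [k gk] := choice gU.
have kpot : potential N o k by exact: (green_limit_potential _ iU gk).
have := gk x; rewrite -(huniq _ kpot) => /cvgrPdist_lt /(_ _ e0) Ue.
have UD : U D by apply: DU; exact: withinT.
by have [v []] := @filter_ex _ U _ _ (@filterI _ U _ _ _ UD Ue).
Qed.

End Representation.

(** * Change of root and the determinant formula *)

Section RootChange.
Context {R : realType} {V : choiceType} (N : network R V).
Context {d} {Omega : measurableType d} (W : network_walk N Omega).
Context (Hrec : recurrent W).
Local Notation lap := (laplacian N).

(** The pole of the Green density at [o] cancels the unit Laplacian of [h] there; its own unit
    Laplacian at [o'] remains. *)
Lemma laplacian_root_change o o' (h : V -> R) a v : o != o' ->
  potential N o h ->
  lap (fun x => h x + green W o' x o - a) v = (v == o')%:R.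
Proof.
move=> oo' [_ _ h1 hh].
rewrite (laplacianD _ (fun x => h x + green W o' x o)) laplacian_cst addr0.
rewrite laplacianD; have [->|vo'] := eqVneq v o'.
  by rewrite green_laplacian_root// hh 1?eq_sym// add0r.
rewrite green_laplacian//; have [->|vo] := eqVneq v o.
  by rewrite h1 subrr.
by rewrite hh// oppr0 addr0.
Qed.

(** Nonnegativity comes from the minimum principle: the new function is at least [- h o'], harmonic
    off [o'] and 0 at [o']. *)
Lemma potential_root_change o o' (h : V -> R) : potential N o h ->
  potential N o' (fun x => h x + green W o' x o - h o').
Proof.
move=> hpot; have [h0 ho _ _] := hpot.
have [<-|oo'] := eqVneq o o'.
  rewrite (_ : (fun x => _) = h)//; apply/funext => x.
  by rewrite ho subr0 green_sym// green_root// addr0.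
have lapE v := laplacian_root_change (h o') v oo' hpot.
have ho' : h o' + green W o' o' o - h o' = 0 by rewrite green_root//; ring.
split=> //; last 2 first.
- by rewrite lapE eqxx.
- by move=> v vo'; rewrite lapE (negPf vo').
apply: (min_principle_point Hrec (a := o') (M := h o')).
- by move=> v; have := h0 v; have := green_ge0 Hrec o' v o; lra.
- move=> v vo'; rewrite (laplacian_eq0 N _ v).1// lapE.
  by rewrite (negPf vo').
- by rewrite ho'.
Qed.

(** The pole of the first term at [o] is cancelled by the unit Laplacian of the second, leaving a
    bounded function harmonic off [o'], hence a constant. Changing the root back and forth is
    thereby the identity. *)
Lemma green_root_change o o' x : o != o' ->
  green W o' x o + green W o x o' = green W o o' o'.
Proof.
move=> oo'.
have [M gM] := green_bounded Hrec o' o; have [M' gM'] := green_bounded Hrec o o'.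
move: x; apply: (bounded_laplacian_eq Hrec (fset1_neq0 o') (M := M + M')
  (M' := `|green W o o' o'|)) => //.
- by move=> v; apply: le_trans (ler_normD _ _) _; rewrite lerD.
- move=> v; rewrite inE => vo'; rewrite laplacianD laplacian_cst.
  rewrite green_laplacian//; have [->|vo] := eqVneq v o.
    by rewrite green_laplacian_root 1?eq_sym// addNr.
  by rewrite green_laplacian// (negPf vo') oppr0 addr0.
- by move=> v; rewrite inE => /eqP->; rewrite green_root// add0r.
Qed.

(** A potential [k] at [o'] transported to [o] must be [h]; transporting back recovers [k]. *)
Lemma unique_potential_root_change o o' (h : V -> R) : o != o' ->
  unique (potential N o) h ->
  unique (potential N o') (fun x => h x + green W o' x o - h o').
Proof.
move=> oo' [hpot huniq]; split; first exact: potential_root_change.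
move=> k kpot; have [_ ko' _ _] := kpot.
rewrite (huniq _ (potential_root_change o kpot)); apply/funext => x.
have := green_root_change x oo'; rewrite ko'; lra.
Qed.

End RootChange.

(** * Existence of harmonic measure from infinity and Cramer's rule *)

Section HarmonicMeasureFromInfinity.
Context {R : realType} {V : choiceType} (N : network R V).
Context {d} {Omega : measurableType d} (W : network_walk N Omega).
Context (Hrec : recurrent W).
Implicit Types (A : {fset V}).
Local Notation lap := (laplacian N).
Local Notation hm := (harmonic_measure W).

Lemma harmonic_measure_green o A x z : o \in A -> z \in A -> z != o ->
  hm A x z = \sum_(y <- (A `\ o)%fset) - lap (hm A ^~ z) y * green W o x y.
Proof.
move=> oA zA zo; apply: (green_decomposition Hrec (f := hm A ^~ z) (M := 1)).
- by move=> v; exact: harmonic_measure_norm_le1.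
- by rewrite harmonic_measure_in// eq_sym (negPf zo).
- by move=> v vA _; apply/laplacian_eq0; rewrite harmonic_measure_harmonic.
Qed.

Lemma harmonic_measure_cvg o A z (h : V -> R) : unique (potential N o) h ->
  o \in A -> z \in A -> z != o ->
  hm A v z @[v --> @vertex_infty V] -->
    \sum_(y <- (A `\ o)%fset) - lap (hm A ^~ z) y * h y.
Proof.
move=> hu oA zA zo; have FF := vertex_infty_proper N.
under eq_cvg do rewrite (harmonic_measure_green _ oA zA zo).
apply: cvg_big; first exact: add_continuous.
move=> y _; apply: cvgM; first exact: cvg_cst.
under eq_cvg do rewrite green_sym//.
exact: unique_potential_green_limit.
Qed.

Lemma unique_potential_admits o A (h : V -> R) : unique (potential N o) h ->
  o \in A -> admits_harmonic_measure W A.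
Proof.
move=> hu oA z zA; have FF := vertex_infty_proper N.
have [->|zo] := eqVneq z o; last first.
  exact: cvgP (harmonic_measure_cvg hu oA zA zo).
have A0 : A != fset0 by apply/fset0Pn; exists o.
pose l z := \sum_(y <- (A `\ o)%fset) - lap (hm A ^~ z) y * h y.
(* The root receives the mass left over by the other points of [A]. *)
apply: (cvgP (1 - \sum_(z <- (A `\ o)%fset) l z)).
rewrite (_ : hm A ^~ o = fun v => 1 - \sum_(z <- (A `\ o)%fset) hm A v z).
  apply: cvgB; first exact: cvg_cst.
  under eq_cvg do rewrite big_seq; rewrite big_seq.
  apply: cvg_big; first exact: add_continuous.
  by move=> y; rewrite !inE => /andP[yo yA]; exact: harmonic_measure_cvg.
apply/funext => v; rewrite -(harmonic_measure_sum Hrec v A0).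
by rewrite (big_fsetD1 o)//= addrK.
Qed.

Lemma potential_harmonic_measure o z (h : V -> R) :
  unique (potential N o) h -> z != o ->
  h z = harmonic_measure_infty W [fset o; z]%fset z * green W o z z.
Proof.
move=> hu zo; have FF := vertex_infty_proper N.
have g0 := green_diag_gt0 Hrec zo.
suff -> : harmonic_measure_infty W [fset o; z]%fset z = h z / green W o z z.
  by rewrite divfK// gt_eqF.
apply: cvg_lim => //.
under eq_cvg => v.
  rewrite -[harmonic_measure _ _ _ _](mulfK (lt0r_neq0 g0)) -green_hit//.
  rewrite green_sym//; over.
apply: cvgM; [exact: unique_potential_green_limit|exact: cvg_cst].
Qed.

(** The two-point sets containing [o] supply the limit of each Green density; this limit is a
    potential, and the only candidate. *)
Lemma all_admit_unique_potential o :
  (forall A, A != fset0 -> admits_harmonic_measure W A) ->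
  exists! h : V -> R, potential N o h.
Proof.
move=> adm; have FF := vertex_infty_proper N.
pose h x := harmonic_measure_infty W [fset o; x]%fset x * green W o x x.
have gh x : green W o x v @[v --> @vertex_infty V] --> h x.
  under eq_cvg do rewrite green_sym// green_hit//.
  apply: cvgM; last exact: cvg_cst.
  apply: adm; last by rewrite !inE eqxx orbT.
  by apply/fset0Pn; exists o; rewrite !inE eqxx.
exists h; split; first exact: (green_limit_potential Hrec (F := @vertex_infty V)).
move=> k kpot; apply/funext => x.
by rewrite (potential_green_limit Hrec kpot (gh x)).
Qed.

Lemma sum_fset_elt (B : {fset V}) (F : V -> R) :
  \sum_(y <- B) F y = \sum_(i < #|`B|) F (fset_elt i).
Proof. exact: big_tnth. Qed.

Lemma fset_elt_in (B : {fset V}) (i : 'I_#|`B|) : fset_elt i \in B.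
Proof. exact: mem_tnth. Qed.

Lemma fset_elt_eq (B : {fset V}) (i j : 'I_#|`B|) :
  (fset_elt i == fset_elt j) = (i == j).
Proof.
by rewrite /fset_elt !(tnth_nth (fset_elt i)) /= nth_uniq.
Qed.

Lemma fset_eltP (B : {fset V}) z : z \in B -> exists i : 'I_#|`B|, fset_elt i = z.
Proof. by move=> /(tnthP (in_tuple (enum_fset B)))[i ->]; exists i. Qed.

(** Column [j] holds the charges representing the harmonic measure of the [j]-th vertex by Green
    densities. *)
Definition charge_mx o A : 'M[R]_#|`(A `\ o)%fset| :=
  \matrix_(i, j) - lap (hm A ^~ (fset_elt j)) (fset_elt i).

(** The Green representation evaluated on [A], where harmonic measure is a Kronecker delta. *)
Lemma green_mx_charge o A : o \in A ->
  green_mx W o (A `\ o)%fset *m charge_mx o A = 1%:M.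
Proof.
move=> oA; apply/matrixP => i j; rewrite !mxE.
have /fsetD1P[jo jA] := fset_elt_in j; have /fsetD1P[io iA] := fset_elt_in i.
rewrite -fset_elt_eq -(harmonic_measure_in W _ iA).
rewrite (harmonic_measure_green _ oA jA jo) sum_fset_elt.
by apply: eq_bigr => k _; rewrite !mxE mulrC.
Qed.

Lemma green_mx_unit o A : o \in A -> green_mx W o (A `\ o)%fset \in unitmx.
Proof. by move=> /green_mx_charge/mulmx1_unit[]. Qed.

Lemma tr_green_mx o (B : {fset V}) : (green_mx W o B)^T = green_mx W o B.
Proof. by apply/matrixP => i j; rewrite !mxE green_sym. Qed.

Lemma harmonic_measure_det o A z (h : V -> R) : unique (potential N o) h ->
  o \in A -> z \in (A `\ o)%fset ->
  harmonic_measure_infty W A z =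
  \det (green_mx_col W o (A `\ o)%fset h z) / \det (green_mx W o (A `\ o)%fset).
Proof.
move=> hu oA zB; have FF := vertex_infty_proper N.
have /fsetD1P[zo zA] := zB.
rewrite /harmonic_measure_infty.
rewrite (cvg_lim _ (harmonic_measure_cvg hu oA zA zo))//.
set M := green_mx W o _; set M' := green_mx_col _ _ _ _ _.
have [j jz] := fset_eltP zB.
have Mu : M \in unitmx by exact: green_mx_unit.
have CE : charge_mx o A = invmx M.
  by rewrite -[LHS]mul1mx -(mulVmx Mu) -mulmxA green_mx_charge// mulmx1.
(* These cofactors omit column [j], the only one in which the two matrices differ. *)
have cofE i : cofactor M' i j = cofactor M i j.
  rewrite /cofactor; congr (_ * \det _); apply/matrixP => a b; rewrite !mxE.
  by rewrite -jz fset_elt_eq eq_sym (negPf (neq_lift _ _)).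
rewrite sum_fset_elt (expand_det_col M' j) mulr_suml; apply: eq_bigr => i _.
rewrite cofE !mxE jz eqxx mulrC -mulrA; congr (_ * _).
transitivity (charge_mx o A i j); first by rewrite mxE jz.
(* The inverse is built from transposed cofactors; symmetry of the Green matrix undoes the
   transposition. *)
by rewrite CE /invmx Mu !mxE -cofactor_tr tr_green_mx mulrC.
Qed.

End HarmonicMeasureFromInfinity.

Local Open Scope fset_scope.
Local Open Scope ring_scope.

Theorem theorem3p2 (R : realType) (V : choiceType) (N : network R V) (o : V)
    (d : measure_display) (Omega : measurableType d)
    (W : network_walk N Omega) (Hrec : recurrent W) :
  ((exists! h : V -> R, potential N o h) <->
   (forall A : {fset V}, A != fset0 -> admits_harmonic_measure W A)) /\
  (forall h : V -> R, unique (potential N o) h ->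
   [/\ (forall z : V, z != o ->
          h z = harmonic_measure_infty W [fset o; z] z * green W o z z),
       (forall A : {fset V}, o \in A ->
          green_mx W o (A `\ o) \in unitmx /\
          (forall z : V, z \in A `\ o ->
             harmonic_measure_infty W A z =
             \det (green_mx_col W o (A `\ o) h z) /
             \det (green_mx W o (A `\ o))))
     & (forall (A : {fset V}) (o' : V), o \notin A -> o' \in A ->
          let h' := fun x : V => h x + green W o' x o - h o' in
          unique (potential N o') h' /\
          green_mx W o' (A `\ o') \in unitmx /\
          (forall z : V, z \in A `\ o' ->
             harmonic_measure_infty W A z =
             \det (green_mx_col W o' (A `\ o') h' z) /
             \det (green_mx W o' (A `\ o'))))]).
Proof.
split.
  split; last exact: all_admit_unique_potential.
  move=> [h hu] A /fset0Pn[a aA].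
  (* The root is moved to the point [a] of [A] unless it is already there. *)
  have [oa|oa] := eqVneq o a.
    by apply: (unique_potential_admits Hrec hu); rewrite oa.
  exact: (unique_potential_admits Hrec (unique_potential_root_change Hrec oa hu)).
move=> h hu; split.
- by move=> z zo; exact: potential_harmonic_measure.
- move=> A oA; split; first exact: green_mx_unit.
  by move=> z zA; exact: harmonic_measure_det.
- move=> A o' oA o'A h'.
  have oo' : o != o' by apply: contraNneq oA => ->.
  have h'u : unique (potential N o') h' by exact: unique_potential_root_change.
  split=> //; split; first exact: green_mx_unit.
  by move=> z zA; exact: harmonic_measure_det.
Qed.
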